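(* Let $s=p\oplus qr^*$ and $s'=p'\oplus q'r'^*$ be ultimately periodic counters in canonical form, with $r=\nu\delta^{\tau}$, $r'=\nu'\delta^{\tau'}$, and with $T_1$, $T'_1$ the $\delta$-exponents of the first monomials of $q$, $q'$ respectively. Put $$\tau''=\mathrm{lcm}(\tau,\tau'),\qquad \nu''=\tau''\left(\frac{\nu}{\tau}+\frac{\nu'}{\tau'}\right),\qquad t''_{\mathrm p}=\max(T_1,T'_1).$$ Then the series $s''=s\odot s'$ is periodic with periodic pattern described by $\tau''$, $\nu''$, $t''_{\mathrm p}$; that is, $$s''(t+k\tau'')=k\nu''+s''(t)\qquad\text{for all integers } t\ge t''_{\mathrm p},\ k\ge 0.$$
   Context: Let $\overline{\mathbb Z}=\mathbb Z\cup\{-\infty,+\infty\}$ with its standard order. A counter is a map $s:\overline{\mathbb Z}\to\overline{\mathbb Z}$ that is non-decreasing for the standard order and satisfies $s(-\infty)=-\infty$, $s(+\infty)=+\infty$; $\Sigma$ is the set of counters. Thus a counter is determined by its values on $\mathbb Z$. Sums $\oplus$ (finite or infinite) of counters are pointwise standard minima (infima) on $\mathbb Z$. The Hadamard product of $s_1,s_2\in\Sigma$ is the counter $s_1\odot s_2$ with $(s_1\odot s_2)(t)=s_1(t)+s_2(t)$ for all $t\in\mathbb Z$, where $(+\infty)+(-\infty)=+\infty$. The monomial $n\delta^{t_0}$ denotes the counter with value $n$ at every $t\in\mathbb Z$ with $t\le t_0$ and $+\infty$ at every $t\in\mathbb Z$ with $t>t_0$. Ultimately periodic counters: these are counters of the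 form $s=p\oplus qr^*$ with $p=\bigoplus_{i=1}^{m}n_i\delta^{t_i}$ (transient part, possibly absent, i.e. $m=0$), $q=\bigoplus_{i=1}^{l}N_i\delta^{T_i}$ (periodic pattern, $l\ge1$), $r=\nu\delta^{\tau}$, with exponents $t_i,T_i\in\mathbb Z$, $\nu\in\mathbb Z$, $\tau\in\mathbb Z$, $\tau\ge 1$; the coefficients and exponents are listed in increasing standard order ($n_1<\dots<n_m<N_1<\dots<N_l$ and $t_1<\dots<t_m<T_1<\dots<T_l$). Here $qr^*=\bigoplus_{k\ge0}\bigoplus_{i=1}^{l}(N_i+k\nu)\delta^{T_i+k\tau}$. In such a representation $T_1$ is the beginning of the periodic regime: $s(t+k\tau)=k\nu+s(t)$ for all integers $t\ge T_1$, $k\ge0$. The representation is in canonical form if $m$ is minimal among all such representations of $s$. The same conventions, with primes, apply to $s'=p'\oplus q'r'^*$. *)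

(* Defs.v *)
From HB Require Import structures.
From mathcomp Require Import all_boot all_order all_algebra.
From mathcomp Require Import boolp classical_sets constructive_ereal.

Set Implicit Arguments.
Unset Strict Implicit.
Unset Printing Implicit Defensive.

Import Order.TTheory GRing.Theory Num.Theory.

Local Open Scope classical_set_scope.
Local Open Scope ring_scope.

Record counter := Counter {
  counter_fun :> \bar int -> \bar int;
  counter_homo : {homo counter_fun : x y / (x <= y)%E};
  counter_Ny : counter_fun -oo%E = -oo%E;
  counter_y : counter_fun +oo%E = +oo%E }.

Lemma counterP (s1 s2 : counter) :
  (forall t : int, s1 t%:E = s2 t%:E) -> s1 = s2.
Proof.
case: s1 s2 => [f1 h1 N1 y1] [f2 h2 N2 y2] /= f12.
have f12E : f1 = f2.
  by apply/funext => -[t||]; rewrite ?f12 ?N1 ?N2 ?y1 ?y2.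
case: _ / f12E in h2 N2 y2 f12 *.
by congr Counter; apply: Prop_irrelevance.
Qed.

Section OfFinite.
Variable f : int -> \bar int.
Hypothesis f_homo : forall x y : int, x <= y -> (f x <= f y)%E.

Definition extend (x : \bar int) : \bar int :=
  match x with t%:E => f t | +oo%E => +oo%E | -oo%E => -oo%E end.

Fact extend_homo : {homo extend : x y / (x <= y)%E}.
Proof.
case=> [x||] [y||] //= xy; rewrite ?leey ?leNye //.
by apply: f_homo; rewrite -lee_fin.
Qed.

Definition counter_of : counter :=
  Counter extend_homo (erefl _) (erefl _).
End OfFinite.

(* every subset of \bar int has an infimum, so that [infimum] below never
   takes its default value on a nonempty set *)
Lemma infimums_bar_int (A : set (\bar int)) : infimums A !=set0.
Proof.
have [Any|nAny] := pselect (A -oo%E).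
  exists -oo%E; split=> [x _|y /(_ _ Any)//]; exact: leNye.
have [[r Ar]|nA] := pselect (exists r : int, A r%:E); last first.
  exists +oo%E; split=> [[x|//|//] Ax|y _]; last exact: leey.
  by case: nA; exists x.
have [[b bA]|nb] := pselect (exists b : int, lbound A b%:E); last first.
  exists -oo%E; split=> [x _|[y||] yA]; rewrite ?leNye//.
    by case: nb; exists y.
  by move: (yA _ Ar).
have exn : exists n : nat, `[< A (b + n%:Z)%:E >].
  exists `|r - b|%N; apply/asboolP; rewrite gez0_abs ?subrKC//.
  by rewrite subr_ge0 -lee_fin; exact: bA.
case: (ex_minnP exn) => n /asboolP An nmin.
exists (b + n%:Z)%:E; split=> [[x||] Ax|y /(_ _ An)//]; rewrite ?leey//.
have bx : b <= x by rewrite -lee_fin; exact: bA.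
rewrite lee_fin -lerBrDl.
have := nmin `|x - b|%N; rewrite gez0_abs ?subr_ge0// subrKC.
by move=> /(_ (asboolT Ax)); rewrite -lez_nat gez0_abs// subr_ge0.
Qed.

Lemma le_infimum (A : set (\bar int)) (v : \bar int) :
  (v <= infimum +oo A)%E <-> lbound A v.
Proof.
rewrite /infimum; case: ifPn => [/eqP ->|_]; first by rewrite leey; split=> // _ x [].
case: xgetP => [y _ [yA Ay]|noinf]; last first.
  by have [z /noinf] := infimums_bar_int A.
split=> [vy x Ax|/Ay//]; exact: le_trans vy (yA _ Ax).
Qed.

Fact csum_homo (I : Type) (f : I -> counter) (x y : int) : x <= y ->
  (infimum +oo [set f i x%:E | i in [set: I]] <=
   infimum +oo [set f i y%:E | i in [set: I]])%E.
Proof.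
move=> xy; apply/le_infimum => _ [i _ <-].
apply: (@le_trans _ _ (f i x%:E)); last by apply: counter_homo; rewrite lee_fin.
by move: (lexx (infimum +oo%E [set f i x%:E | i in [set: I]])) => /le_infimum;
   apply; exists i.
Qed.

Definition csum (I : Type) (f : I -> counter) : counter :=
  counter_of (@csum_homo I f).

Definition cadd (s1 s2 : counter) : counter.
Proof.
exists (fun x => Order.min (s1 x) (s2 x)).
- by move=> x y xy; rewrite le_min !ge_min !counter_homo ?orbT.
- by rewrite !counter_Ny minxx.
- by rewrite !counter_y minxx.
Defined.

(* the empty sum *)
Definition czero : counter :=
  @counter_of (fun=> +oo%E) (fun x y _ => lexx _).

Fact hadamard_homo (s1 s2 : counter) (x y : int) : x <= y ->
  ((s1 x%:E + s2 x%:E)%dE <= (s1 y%:E + s2 y%:E)%dE)%E.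
Proof.
move=> xy; apply: DualAddTheoryRealDomain.lee_dD; apply: counter_homo; by rewrite lee_fin.
Qed.

(* %dE is the dual addition of \bar int: +oo + -oo = +oo *)
Definition hadamard (s1 s2 : counter) : counter :=
  @counter_of (fun t => (s1 t%:E + s2 t%:E)%dE) (@hadamard_homo s1 s2).

Fact cmonomial_homo (n t0 x y : int) : x <= y ->
  ((if (x <= t0)%R then n%:E else +oo) <=
   (if (y <= t0)%R then n%:E else +oo))%E.
Proof.
move=> xy; case: (leP y t0) => [/(le_trans xy) ->|_]; rewrite ?leey ?lexx//.
Qed.

Definition cmonomial (n t0 : int) : counter :=
  @counter_of (fun t => if t <= t0 then n%:E else +oo%E)
    (@cmonomial_homo n t0).

(* A polynomial is given by the list of the (coefficient, exponent) pairs of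
   its monomials. *)
Definition cpoly (w : seq (int * int)) : counter :=
  \big[cadd/czero]_(x <- w) cmonomial x.1 x.2.

(* data of an expression p (+) q r^* with r = nu delta^tau *)
Record upexpr := UPExpr {
  up_p : seq (int * int);
  up_q : seq (int * int);
  up_nu : int;
  up_tau : int }.

Definition up_T1 (u : upexpr) : int := (head (0, 0) (up_q u)).2.

Definition up_qrstar (u : upexpr) : counter :=
  csum (fun k : nat =>
    cpoly [seq (x.1 + k%:Z * up_nu u, x.2 + k%:Z * up_tau u) | x <- up_q u]).

Definition up_counter (u : upexpr) : counter :=
  cadd (cpoly (up_p u)) (up_qrstar u).

Definition lt_mono : rel (int * int) :=
  fun x y => (x.1 < y.1) && (x.2 < y.2).

(* As [lt_mono] is transitive, the second condition says that n_1 < ... < n_m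
   < N_1 < ... < N_l and t_1 < ... < t_m < T_1 < ... < T_l. *)
Definition up_wf (u : upexpr) : Prop :=
  [/\ up_q u != [::], sorted lt_mono (up_p u ++ up_q u) & 1 <= up_tau u].

Definition periodic_from (s : counter) (T nu tau : int) : Prop :=
  forall (t : int) (k : nat), T <= t ->
    s (t + k%:Z * tau)%:E = ((k%:Z * nu)%:E + s t%:E)%E.

(* That T_1 is the beginning of the periodic regime does not follow from
   [up_wf] when q extends over more than one period: for
   q = 0 delta^0 (+) 1 delta^10 and r = 1 delta^1 the counter takes the values
   0 at 0 and 1 at 1, ..., 10.  It is therefore part of what a representation
   is; [periodic_up_counter] derives it when T_l < T_1 + tau. *)
Definition up_represents (u : upexpr) (s : counter) : Prop :=
  [/\ up_wf u, s = up_counter u & periodic_from s (up_T1 u) (up_nu u) (up_tau u)].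

Definition up_canonical (u : upexpr) (s : counter) : Prop :=
  up_represents u s /\
  forall v : upexpr, up_represents v s -> (size (up_p u) <= size (up_p v))%N.

Lemma le_cpoly (w : seq (int * int)) (t : int) (v : \bar int) :
  (v <= cpoly w t%:E)%E <->
  (forall x, x \in w -> t <= x.2 -> (v <= x.1%:E)%E).
Proof.
rewrite /cpoly; elim: w => [|x w IH].
  by rewrite big_nil /= leey; split.
rewrite big_cons /= le_min; split=> [/andP[vx /IH vw] y|H].
  rewrite inE => /orP[/eqP ->|/vw//] tx.
  by move: vx; rewrite tx.
apply/andP; split; last by apply/IH => y yw; apply: H; rewrite inE yw orbT.
by case: ifP => [tx|]; rewrite ?leey//; apply: H; rewrite ?mem_head.
Qed.

Lemma le_up_qrstar (u : upexpr) (t : int) (v : \bar int) :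
  (v <= up_qrstar u t%:E)%E <->
  (forall (k : nat) x, x \in up_q u -> t <= x.2 + k%:Z * up_tau u ->
     (v <= (x.1 + k%:Z * up_nu u)%:E)%E).
Proof.
rewrite /=; split=> [/le_infimum H k x xq tx|H].
  have := H _ (ex_intro2 _ _ k I erefl) => /le_cpoly.
  move=> /(_ (x.1 + k%:Z * up_nu u, x.2 + k%:Z * up_tau u)); apply=> //.
  by apply/mapP; exists x.
apply/le_infimum => _ [k _ <-]; apply/le_cpoly => _ /mapP[x xq ->] /=.
exact: H.
Qed.

Lemma periodic_up_counter (u : upexpr) : up_wf u ->
  (last (0, 0) (up_q u)).2 < up_T1 u + up_tau u ->
  periodic_from (up_counter u) (up_T1 u) (up_nu u) (up_tau u).
Proof.
case: u => p [|x0 q] nu tau [//= _ srt tau1].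
rewrite /up_T1 /= => lastq t k T1t.
have tr : transitive lt_mono.
  move=> b a c /andP[ab1 ab2] /andP[bc1 bc2].
  by rewrite /lt_mono (lt_trans ab1 bc1) (lt_trans ab2 bc2).
have [pq [_ srtq]] : (forall x, x \in p -> x.2 < x0.2) /\
    (sorted lt_mono p /\ sorted lt_mono (x0 :: q)).
  move: srt; rewrite (sorted_pairwise tr) pairwise_cat -!(sorted_pairwise tr).
  move=> /and3P[/allrelP pq sp sq]; split=> // x xp.
  by have /andP[] := pq x x0 xp (mem_head _ _).
have qlast x : x \in x0 :: q -> x.2 <= (last x0 q).2.
  move: srtq {pq srt lastq T1t}; elim/last_ind: q => [_|q y _].
    by rewrite inE => /eqP ->.
  rewrite last_rcons -rcons_cons (sorted_pairwise tr) -cats1 pairwise_cat.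
  move=> /and3P[/allrelP H _ _]; rewrite mem_cat mem_seq1 => /orP[xq|/eqP -> //].
  by have /andP[_ /ltW] := H x y xq (mem_head _ _).
set u := UPExpr p (x0 :: q) nu tau.
have valE r : x0.2 <= r -> up_counter u r%:E = up_qrstar u r%:E.
  move=> T1r; rewrite /up_counter [LHS]/=; apply/min_idPr.
  apply: (@le_trans _ _ +oo%E); rewrite ?leey//.
  apply/le_cpoly => x xp rx.
  by have := lt_le_trans (pq _ xp) T1r; rewrite ltNge rx.
have kt0 : 0 <= k%:Z * tau by rewrite mulr_ge0// (le_trans _ tau1).
rewrite !valE//; last by rewrite (le_trans T1t)// lerDl.
apply/eqP; rewrite eq_le; apply/andP; split.
  rewrite addeC -leeBlDr// ; apply/le_up_qrstar => j x xq tx.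
  rewrite leeBlDr// -EFinD.
  have : (up_qrstar u (t + k%:Z * tau)%:E <= (x.1 + (j + k)%N%:Z * nu)%:E)%E.
    apply: (iffLR (le_up_qrstar _ _ _) (lexx _)) => //=.
    by rewrite PoszD mulrDl addrA lerD2r.
  by rewrite PoszD mulrDl addrA.
apply/le_up_qrstar => j x xq /= tx.
have [kj|jk] := leqP k j; last first.
  have : t + tau <= x.2.
    have : x.2 + (j%:Z + 1) * tau <= x.2 + k%:Z * tau.
      rewrite lerD2l ler_pM2r ?(lt_le_trans _ tau1)//.
      by move: jk; rewrite -lez_nat -addn1 PoszD.
    rewrite mulrDl mul1r => H; rewrite -(lerD2r (k%:Z * tau)).
    rewrite addrAC; apply: le_trans H; rewrite addrA lerD2r//.
  move=> H; have := le_lt_trans (le_trans H (qlast _ xq)) lastq.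
  by rewrite ltrD2r ltNge T1t.
rewrite addeC -leeBrDr// -EFinB -addrA -mulrBl subzn//.
apply: (iffLR (le_up_qrstar u t _) (lexx _)) => //=.
by rewrite -subzn// mulrBl addrA lerBrDr.
Qed.

(* Main.v *)
Require Import Defs.
From mathcomp Require Import all_boot all_order all_algebra.
From mathcomp Require Import boolp classical_sets constructive_ereal.
From mathcomp Require Import ring.
Import Order.TTheory GRing.Theory Num.Theory.
Local Open Scope ring_scope.

(** A periodic regime survives a later start and a multiple of its period, the increment being
    scaled alike. Writing the lcm as [a * tau = a' * tau'] gives both counters a common period and
    start, and pointwise addition then adds the increments [a * nu] and [a' * nu']. *)

Lemma periodic_from_le (s : counter) (T T' nu tau : int) :
  T <= T' -> periodic_from s T nu tau -> periodic_from s T' nu tau.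
Proof. by move=> TT' sP t k T't; apply: sP; exact: le_trans T't. Qed.

(** Making [k] long steps amounts to making [k * a] short ones. *)
Lemma periodic_from_mul (s : counter) (T nu tau : int) (a : nat) :
  periodic_from s T nu tau -> periodic_from s T (a%:Z * nu) (a%:Z * tau).
Proof. by move=> sP t k Tt; rewrite !mulrA -!PoszM; exact: sP. Qed.

Lemma periodic_from_hadamard (s s' : counter) (T nu nu' tau : int) :
  periodic_from s T nu tau -> periodic_from s' T nu' tau ->
  periodic_from (hadamard s s') T (nu + nu') tau.
Proof.
move=> sP s'P t k Tt /=; rewrite sP// s'P//.
(* An infinite value absorbs the finite increments, so only the finite case is left. *)
case: (s t%:E) (s' t%:E) => [x||] [y||] //=.
by rewrite -!EFinD; congr EFin; ring.
Qed.

(** The quotient is taken in [nat] because [periodic_from] only iterates forward. *)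
Lemma dvdz_natmul (d m : int) :
  0 < d -> (d %| m)%Z -> 0 <= m -> exists a : nat, m = a%:Z * d.
Proof.
move=> d0 /dvdzP[a mE] m0; exists `|a|%N.
by rewrite gez0_abs// -(pmulr_lge0 _ d0) -mE.
Qed.

Theorem proposition3p3 (s s' : counter) (u u' : upexpr)
    (hs : up_canonical u s) (hs' : up_canonical u' s') :
  let tau'' := lcmz (up_tau u) (up_tau u') in
  let tp'' := Num.max (up_T1 u) (up_T1 u') in
  exists nu'' : int,
    nu''%:~R = tau''%:~R * ((up_nu u)%:~R / (up_tau u)%:~R +
                            (up_nu u')%:~R / (up_tau u')%:~R) :> rat /\
    periodic_from (hadamard s s') tp'' nu'' tau''.
Proof.
move=> tau'' tp''.
have [[[_ _ tau_gt0] _ sP] _] := hs; have [[[_ _ tau'_gt0] _ s'P] _] := hs'.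
(* Over [int], [1 <= tau] is convertible to [0 < tau]; [isT] suffices because [lcmz] is a cast
   natural number. *)
have [a aE] := dvdz_natmul _ _ tau_gt0 (dvdz_lcml _ (up_tau u')) isT.
have [a' a'E] := dvdz_natmul _ _ tau'_gt0 (dvdz_lcmr (up_tau u) _) isT.
exists (a%:Z * up_nu u + a'%:Z * up_nu u'); split.
  have tau_neq0 : (up_tau u)%:~R != 0 :> rat by rewrite intr_eq0 gt_eqF.
  have tau'_neq0 : (up_tau u')%:~R != 0 :> rat by rewrite intr_eq0 gt_eqF.
  (* Each copy of [tau''] is expanded as a multiple of the denominator it meets, which then
     cancels. *)
  rewrite mulrDr {1}/tau'' aE /tau'' a'E !rmorphD !rmorphM /=.
  by congr (_ + _); field.
apply: periodic_from_hadamard.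
- apply: (@periodic_from_le _ (up_T1 u)); first by rewrite le_max lexx.
  by rewrite /tau'' aE; exact: periodic_from_mul.
- apply: (@periodic_from_le _ (up_T1 u')); first by rewrite le_max lexx orbT.
  by rewrite /tau'' a'E; exact: periodic_from_mul.
Qed.
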